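(* Let $M$ be Lebesgue measure on $\mathcal X=\mathcal X_1\times\mathcal X_2\times\cdots\times\mathcal X_q$ with open intervals $\mathcal X_k\subset\mathbb R$, and let $(Q_\xi)_{\xi\in\Xi}$ be a family of probability distributions on $\mathcal X$ with densities $g_\xi>0$ with respect to $M$. Suppose that the following two conditions are satisfied: (i) $(Q_\xi)_{\xi\in\Xi}$ is identifiable; (ii) for arbitrary $\xi\in\Xi$, $k\in\{1,2,\dots,q\}$ and $x_i\in\mathcal X_i$, $i\ne k$, the function $$t\mapsto g_\xi(x_1,\dots,x_{k-1},t,x_{k+1},\dots,x_q)$$ on $\mathcal X_k$ may be extended to a holomorphic function on some open subset of $\mathbb C$ containing $\mathcal X_k$. Then the family $(Q_\xi)_{\xi\in\Xi}$ is locally identifiable.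
   Context: Identifiable. The family $(Q_\xi)_{\xi\in\Xi}$ is called identifiable if the following holds for every $m\in\mathbb N$: whenever $\xi(1),\dots,\xi(m)\in\Xi$ are pairwise different, $\lambda_1,\dots,\lambda_m>0$, and $\xi'(1),\dots,\xi'(m)\in\Xi$, $\lambda_1',\dots,\lambda_m'\ge0$ are such that $$\sum_{j=1}^m\lambda_jQ_{\xi(j)}=\sum_{j=1}^m\lambda_j'Q_{\xi'(j)},$$ then there exists a permutation $\sigma$ of $\{1,\dots,m\}$ such that $\xi'(i)=\xi(\sigma(i))$ and $\lambda_i'=\lambda_{\sigma(i)}$ for $i=1,\dots,m$. Locally identifiable. The family $(Q_\xi)_{\xi\in\Xi}$ (with densities $g_\xi$ with respect to $M$) is called locally identifiable if for arbitrary $m\in\mathbb N$, pairwise different parameters $\xi(1),\dots,\xi(m)\in\Xi$ and numbers $\beta_1,\dots,\beta_m\in\mathbb R$, $$M\Bigl\{x\in\mathcal X:\sum_{j=1}^m\beta_jg_{\xi(j)}(x)=0\Bigr\}>0\quad\text{implies that}\quad\beta_1=\beta_2=\cdots=\beta_m=0.$$ *)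

(* Defs.v *)
From HB Require Import structures.
From mathcomp Require Import all_boot all_order all_algebra all_fingroup.
From mathcomp Require Import all_classical all_reals all_analysis.
From mathcomp Require Import complex.

Set Implicit Arguments.
Unset Strict Implicit.
Unset Printing Implicit Defensive.
Import Order.TTheory GRing.Theory Num.Theory numFieldNormedType.Exports.
Local Open Scope classical_set_scope.
Local Open Scope complex_scope.
Local Open Scope ring_scope.

Definition box (R : realType) (q : nat) (X : 'I_q -> set R) :
    set (q.-tuple R) :=
  [set x | forall k, X k (tnth x k)].

Definition tcons (R : realType) (n : nat)
    (p : measurableTypeR R * n.-tuple R) : n.+1.-tuple R :=
  [tuple of (p.1 : R) :: p.2].

Section lebesgue_tuple.
Context {R : realType}.
Local Open Scope ereal_scope.

Lemma measurable_tcons n : measurable_fun [set: _] (@tcons R n).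
Proof.
apply: (@measurable_cons _ _ _ R (fun p => (p.1 : R)) n (fun p => p.2)).
- exact: (@measurable_fst _ _ (measurableTypeR R)).
- exact: measurable_snd.
Qed.

Definition tuncons n (x : n.+1.-tuple R) : measurableTypeR R * n.-tuple R :=
  (thead x, [tuple of behead x]).

Lemma tconsK n : cancel (@tcons R n) (@tuncons n).
Proof. by case=> a x; congr (_, _); apply/val_inj. Qed.

Lemma tunconsK n : cancel (@tuncons n) (@tcons R n).
Proof. by case=> -[|a x] // ?; exact/val_inj. Qed.

Lemma measurable_tuncons n : measurable_fun [set: _] (@tuncons n).
Proof.
apply: (@measurable_fun_pair _ _ _ _ (measurableTypeR R)).
- exact: (@measurable_tnth _ R n.+1 ord0).
- exact: measurable_behead.
Qed.

Section lebesgue_cons.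
Variables (n : nat) (m : {sigma_finite_measure set (n.-tuple R) -> \bar R}).

Definition lebesgue_cons : set (n.+1.-tuple R) -> \bar R :=
  pushforward (lebesgue_measure \x m) (@tcons R n).

Let lebesgue_cons0 : lebesgue_cons set0 = 0.
Proof. by rewrite /lebesgue_cons /pushforward preimage_set0 measure0. Qed.

Let lebesgue_cons_ge0 A : 0 <= lebesgue_cons A.
Proof. by rewrite /lebesgue_cons /pushforward; exact: measure_ge0. Qed.

Let lebesgue_cons_sigma_additive : semi_sigma_additive lebesgue_cons.
Proof.
by apply: measure_semi_sigma_additive; exact: measurable_tcons.
Qed.

HB.instance Definition _ := isMeasure.Build _ _ _ lebesgue_cons
  lebesgue_cons0 lebesgue_cons_ge0 lebesgue_cons_sigma_additive.

Let lebesgue_cons_sigma_finite : sigma_finite setT lebesgue_cons.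
Proof.
have /sigma_finiteP[F [FT ndF Ffin]] :=
  sigma_finiteT (lebesgue_measure : {sigma_finite_measure set _ -> \bar R}).
have /sigma_finiteP[G [GT ndG Gfin]] := sigma_finiteT m.
exists (fun k => @tuncons n @^-1` (F k `*` G k)).
  apply/seteqP; split => // x _.
  have [i _ Fi] : (\bigcup_k F k) (tuncons x).1 by rewrite -FT.
  have [j _ Gj] : (\bigcup_k G k) (tuncons x).2 by rewrite -GT.
  exists (maxn i j) => //; split.
  - by move: Fi; exact/subsetPset/ndF/leq_maxl.
  - by move: Gj; exact/subsetPset/ndG/leq_maxr.
move=> k; have [mF Foo] := Ffin k; have [mG Goo] := Gfin k; split.
  rewrite -[X in measurable X]setTI; apply: measurable_tuncons => //.
  exact: measurableX.
rewrite /lebesgue_cons /pushforward -comp_preimage.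
rewrite (_ : _ \o _ = id); last by apply/funext => p; exact: tconsK.
by rewrite preimage_id product_measure1E// lte_mul_pinfty// ge0_fin_numE.
Qed.

HB.instance Definition _ := Measure_isSigmaFinite.Build _ _ _ lebesgue_cons
  lebesgue_cons_sigma_finite.

End lebesgue_cons.

Fixpoint lebesgue_tuple (n : nat) :
    {sigma_finite_measure set (n.-tuple R) -> \bar R} :=
  if n is n'.+1 then lebesgue_cons (lebesgue_tuple n')
  else \d_([tuple] : 0.-tuple R).

Lemma lebesgue_tuple_box n (A : 'I_n -> set R) :
  (forall k, measurable (A k)) ->
  lebesgue_tuple n (box A) = \prod_(k < n) lebesgue_measure (A k).
Proof.
elim: n A => [|n IHn] A mA /=.
  by rewrite big_ord0 diracE mem_set// => -[].
pose B (k : 'I_n) := A (lift ord0 k).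
have mB : measurable (box B).
  rewrite (_ : box B = \bigcap_k ((@tnth _ R ^~ k) @^-1` (B k))); last first.
    by apply/seteqP; split=> [x Bx k _|x Bx k]; [exact: Bx|exact: (Bx k I)].
  apply: fin_bigcap_measurable => // k _.
  rewrite -[X in measurable X]setTI; apply: measurable_tnth => //.
  exact: mA.
rewrite big_ord_recl -IHn; last by move=> k; exact: mA.
rewrite /lebesgue_cons /pushforward.
rewrite (_ : _ @^-1` _ = A ord0 `*` box B); last first.
  apply/seteqP; split => [[a x] Aax|[a x] [/= Aa Bx]] /=.
    split => [|k] /=; first exact: (Aax ord0).
    by have := Aax (lift ord0 k); rewrite tnthS.
  move=> k; case: (unliftP ord0 k) => [j ->|->] //.
  by rewrite tnthS; exact: Bx.
by rewrite product_measure1E//; exact: mA.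
Qed.

End lebesgue_tuple.

(* A probability distribution on D is represented by a probability measure on
   the ambient type; taking A := setT shows that Q is carried by D. *)
Definition is_density d (T : measurableType d) (R : realType)
    (M : {measure set T -> \bar R}) (D : set T)
    (Q : probability T R) (g : T -> R) :=
  measurable_fun D g /\
  forall A, measurable A -> Q A = (\int[M]_(x in A `&` D) (g x)%:E)%E.

Definition mixture d (T : measurableType d) (R : realType) (m : nat)
    (lambda : 'I_m -> R) (P : 'I_m -> probability T R) (A : set T) : \bar R :=
  (\sum_(j < m) (lambda j)%:E * P j A)%E.

Definition identifiable d (T : measurableType d) (R : realType) (Xi : Type)
    (Q : Xi -> probability T R) :=
  forall (m : nat) (xi : 'I_m -> Xi) (lambda : 'I_m -> R)
         (xi' : 'I_m -> Xi) (lambda' : 'I_m -> R),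
    injective xi ->
    (forall j, 0 < lambda j) ->
    (forall j, 0 <= lambda' j) ->
    (forall A, measurable A ->
      mixture lambda (Q \o xi) A = mixture lambda' (Q \o xi') A) ->
    exists s : 'S_m,
      forall i, xi' i = xi (s i) /\ lambda' i = lambda (s i).

Definition locally_identifiable d (T : measurableType d) (R : realType)
    (M : {measure set T -> \bar R}) (D : set T) (Xi : Type)
    (g : Xi -> T -> R) :=
  forall (m : nat) (xi : 'I_m -> Xi) (beta : 'I_m -> R),
    injective xi ->
    (0 < M [set x | D x /\ (\sum_(j < m) beta j * g (xi j) x = 0)%R])%E ->
    forall j, beta j = 0.

(* R[i]^o is C viewed as a normed module over itself, so derivability in the
   direction 1 is complex differentiability. *)
Definition holomorphic_on (R : realType) (U : set R[i]^o)
    (h : R[i]^o -> R[i]^o) :=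
  forall z, U z -> derivable h z 1.

Definition holomorphically_extendable (R : realType) (I : set R)
    (f : R -> R) :=
  exists (U : set R[i]^o) (h : R[i]^o -> R[i]^o),
    [/\ open U, holomorphic_on U h, (forall t, I t -> U t%:C) &
        forall t, I t -> h t%:C = (f t)%:C].

Definition tupdate (R : realType) (q : nat) (x : q.-tuple R) (k : 'I_q)
    (t : R) : q.-tuple R :=
  [tuple if i == k then t else tnth x i | i < q].

(* Main.v *)
Require Import Defs.
From mathcomp Require Import all_boot all_order all_algebra all_fingroup.
From mathcomp Require Import all_classical all_reals all_analysis.
From mathcomp Require Import measurable_realfun complex.
From mathcomp Require Import ring lra.

(** A linear combination [f] of the densities that vanishes on a set of
    positive measure vanishes on the whole box, and then identifiability makes
    all its coefficients zero.

    The first implication is [separately_extendable_eq0], an identity theorem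
    for functions that extend holomorphically in each variable separately. It
    is proved by induction on the dimension. If the zero set has positive
    measure then, by Tonelli, uncountably many of its slices along the first
    coordinate have positive measure, and [f] vanishes on all these slices by
    induction. Hence every line parallel to the first axis carries uncountably
    many zeros of a function of one variable with a holomorphic extension, and
    such a function is zero ([extendable_eq0]).

    The one-variable theorem is derived from complex differentiability alone,
    with contour integrals along boundaries of rectangles. Bisection gives
    Goursat's theorem ([goursat]), and excising a small square gives Cauchy's
    formula ([cauchy_formula]), where it suffices that the integral of
    [(z - a)^-1] is nonzero ([rint_inv_neq0]). Power series are avoided: if [h] has the zeros [a 0, ..., a n.-1], then Cauchy's formula can
    be iterated to
      [h b * I = W b * (contour integral of h z / (W z * (z - b)))],
    where [W] is the product of the linear factors [z - a k] and [I] is the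
    integral of [(z - b)^-1] ([cauchy_interpolation]). If [b] and the zeros are
    close to the centre of a square, compared with its side, then the right
    hand side decays geometrically in [n], so infinitely many zeros near the
    centre force [h b = 0] ([infinitely_many_zeros]).

    The second implication is [identifiable_independent]: if
    [\sum_j beta j * g j = 0], then the mixtures with weights [c + beta j] and
    with constant weights [c] coincide. For large [c] all these weights are
    positive, and identifiability gives [c + beta j = c]. *)

Set Implicit Arguments.
Unset Strict Implicit.
Unset Printing Implicit Defensive.
Import Order.TTheory GRing.Theory Num.Theory numFieldNormedType.Exports.
Local Open Scope classical_set_scope.
Local Open Scope ring_scope.

Local Notation normc := ComplexField.Normc.normc.
Local Notation reC := complex.Re.
Local Notation imC := complex.Im.

(** * The real-valued modulus of a complex number *)

Section complex_modulus.
Variable R : realType.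
Local Open Scope complex_scope.
Local Notation C := R[i]^o.
Implicit Types z w : R[i].

Lemma normc_ge0 z : 0 <= normc z.
Proof. by case: z => a b; exact: sqrtr_ge0. Qed.

Lemma normcD z w : normc (z + w) <= normc z + normc w.
Proof. exact: le_normcD. Qed.

Lemma normcB z w : normc (z - w) <= normc z + normc w.
Proof. by rewrite -(normcN w) normcD. Qed.

Lemma normc_gt0 z : (0 < normc z) = (z != 0).
Proof.
rewrite lt_neqAle normc_ge0 andbT eq_sym; congr (~~ _).
apply/eqP/eqP => [/ComplexField.Normc.eq0_normc//|->].
exact: ComplexField.Normc.normc0.
Qed.

Lemma normc_prod (I : Type) (s : seq I) (P : pred I) (F : I -> R[i]) :
  normc (\prod_(i <- s | P i) F i) = \prod_(i <- s | P i) normc (F i).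
Proof.
elim/big_rec2: _ => [|i x y _ <-]; first exact: ComplexField.Normc.normc1.
exact: ComplexField.Normc.normcM.
Qed.

Lemma normc_real (x : R) : normc x%:C = `|x|.
Proof. by rewrite /= expr0n addr0 sqrtr_sqr. Qed.

Lemma normc_i : normc ('i : R[i]) = 1.
Proof. by rewrite /= expr0n add0r expr1n sqrtr1. Qed.

Lemma ler_Re_normc z : `|reC z| <= normc z.
Proof.
by case: z => a b /=; rewrite -sqrtr_sqr ler_wsqrtr// lerDl sqr_ge0.
Qed.

Lemma ler_Im_normc z : `|imC z| <= normc z.
Proof.
by case: z => a b /=; rewrite -sqrtr_sqr ler_wsqrtr// lerDr sqr_ge0.
Qed.

Lemma normc_le_ReIm z : normc z <= `|reC z| + `|imC z|.
Proof.
case: z => a b; rewrite (_ : a +i* b = a%:C + 'i * b%:C); last first.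
  by apply/eqP; rewrite eq_complex /= !(mul0r, mul1r, subr0, add0r, addr0)
    ?eqxx.
apply: (le_trans (normcD _ _)).
rewrite ComplexField.Normc.normcM normc_i mul1r !normc_real /=.
by rewrite !(mul0r, mul1r, mulr0, subr0, add0r, addr0).
Qed.

Lemma normCE z : `|z| = (normc z)%:C.
Proof. by []. Qed.

(** The norm of [R[i]] takes values in [R[i]]; all estimates are carried out
    with the real number [normc] instead, which this lemma and the next one
    connect to the topology. *)
Lemma continuous_normcP (f : C -> C) (z : C) : {for z, continuous f} <->
  forall e : R, 0 < e ->
    exists2 d : R, 0 < d & forall w, normc (w - z) < d -> normc (f w - f z) < e.
Proof.
split.
  move=> /cvgrPdist_lt cf e e0.
  have /nbhs_ballP [d /= d0 H] := cf e%:C ltac:(by rewrite ltcR).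
  move: d d0 H => [d d']; rewrite ltcE/= => /andP[/eqP -> d0] H.
  exists d => // w wd.
  have := H w; rewrite /ball/= => /(_ _)/wrap[].
    by rewrite distrC normCE ltcR.
  by rewrite distrC normCE ltcR.
move=> H; apply/(@cvgrPdist_lt _ _ _ (nbhs z) _ f (f z)) => -[e e'].
rewrite ltcE/= => /andP[/eqP -> e0].
have [d d0 Hd] := H _ e0; apply/nbhs_ballP; exists d%:C; first by rewrite /= ltcR.
move=> w; rewrite /ball/= distrC => wd.
by rewrite distrC normCE ltcR; apply: Hd; rewrite -ltcR.
Qed.

Lemma derivable_normc (f : C -> C) (z : C) : derivable f z 1 ->
  exists d, forall e : R, 0 < e -> exists2 r : R, 0 < r &
    forall w, normc (w - z) < r ->
      normc (f w - f z - d * (w - z)) <= e * normc (w - z).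
Proof.
move=> /cvg_ex[/= d /cvgrPdist_lt df]; exists d => e e0.
have /nbhs_ballP [r /= r0 H] := df e%:C ltac:(by rewrite ltcR).
move: r r0 H => [r r']; rewrite ltcE/= => /andP[/eqP -> r0] H.
exists r => // w wr.
have [->|wz] := eqVneq w z.
  by rewrite !subrr mulr0 subrr ComplexField.Normc.normc0 mulr0.
have wz0 : w - z != 0 by rewrite subr_eq0.
have := H (w - z); rewrite /ball/= => /(_ _)/wrap[].
  by rewrite sub0r normrN normCE ltcR.
move=> /(_ wz0).
rewrite /GRing.scale/= mulr1 subrK normCE ltcR => /ltW dle.
have -> : f w - f z - d * (w - z) =
          - ((d - (w - z)^-1 * (f w - f z)) * (w - z)).
  by field.
by rewrite normcN ComplexField.Normc.normcM ler_wpM2r// normc_ge0.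
Qed.

Lemma derivable_continuous (f : C -> C) (z : C) :
  derivable f z 1 -> {for z, continuous f}.
Proof. by move=> /derivable1_diffP; exact: differentiable_continuous. Qed.

End complex_modulus.

(** * Integrals of complex-valued functions over an interval *)

Section complex_interval_integral.
Variable R : realType.
Local Open Scope complex_scope.
Local Notation mu := (@lebesgue_measure R).
Implicit Types (a b x : R) (phi psi : R -> R[i]) (c : R[i]).

Definition cintegrable a b phi :=
  mu.-integrable `[a, b] (EFin \o (fun t => reC (phi t))) /\
  mu.-integrable `[a, b] (EFin \o (fun t => imC (phi t))).

Definition cint a b phi : R[i] :=
  (\int[mu]_(t in `[a, b]) reC (phi t)) +i*
  (\int[mu]_(t in `[a, b]) imC (phi t)).

Lemma continuous_cintegrable a b phi :
  (forall t, a <= t <= b -> forall e : R, 0 < e -> exists2 d : R, 0 < d &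
    forall s, `|s - t| < d -> normc (phi s - phi t) < e) ->
  cintegrable a b phi.
Proof.
move=> phic.
have H (f : R -> R^o) :
    (forall s t, `|f s - f t| <= normc (phi s - phi t)) ->
    mu.-integrable `[a, b] (EFin \o f).
  move=> fphi; apply: continuous_compact_integrable.
    exact: segment_compact.
  apply: continuous_in_subspaceT => t /set_mem/=; rewrite in_itv/= => abt.
  apply/(@cvgrPdist_lt _ _ _ (nbhs t) _ f (f t)) => e e0.
  have [d d0 Hd] := phic t abt e e0.
  apply/nbhs_ballP; exists d => //= s; rewrite /ball/= distrC => /Hd.
  by rewrite distrC; apply: le_lt_trans.
split; apply: H => s t.
  by have := ler_Re_normc (phi s - phi t); case: (phi s) (phi t) => ? ? [].
by have := ler_Im_normc (phi s - phi t); case: (phi s) (phi t) => ? ? [].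
Qed.

Lemma eq_cint a b phi psi : (forall t, a <= t <= b -> phi t = psi t) ->
  cint a b phi = cint a b psi.
Proof.
move=> e; congr (_ +i* _); apply: eq_Rintegral => t /set_mem/=;
  by rewrite in_itv/= => /e ->.
Qed.

Lemma cintB a b phi psi : cintegrable a b phi -> cintegrable a b psi ->
  cint a b (fun t => phi t - psi t) = cint a b phi - cint a b psi.
Proof.
move=> [r i] [r' i']; rewrite /cint.
rewrite -[RHS]/(Complex (_ - _) (_ - _)) -!RintegralB//.
by congr Complex; apply: eq_Rintegral => t _; case: (phi t) (psi t) => ? ? [].
Qed.

Lemma cintZ a b c phi : cintegrable a b phi ->
  cint a b (fun t => c * phi t) = c * cint a b phi.
Proof.
case: c => p q [r i]; rewrite /cint.
have K (s : R) (f : R -> R) : mu.-integrable `[a, b] (EFin \o f) ->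
    mu.-integrable `[a, b] (EFin \o (fun t => s * f t)).
  move=> fi; apply: (@eq_integrable _ _ _ mu _ _
    (fun t => s%:E * (EFin \o f) t)%E) => //.
  exact: integrableZl.
rewrite -[RHS]/(Complex (_ - _) (_ + _)) -!RintegralZl//.
rewrite -RintegralB//; do ?exact: K.
rewrite -RintegralD//; do ?exact: K.
by congr Complex; apply: eq_Rintegral => t _; case: (phi t) => ? ?.
Qed.

Lemma cint_cst a b c : a <= b -> cint a b (fun=> c) = c * (b - a)%:C.
Proof.
move=> ab; rewrite /cint !Rintegral_cst//.
have -> : fine (mu `[a, b]) = b - a.
  have := @lebesgue_measure_itv R `[a, b] => /= ->; rewrite lte_fin.
  case: ltP => //= ba; apply/esym/eqP; rewrite subr_eq0.
  by rewrite eq_le ab ba.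
by case: c => p q; apply/eqP; rewrite eq_complex/= !mulr0 subr0 add0r !eqxx.
Qed.

Lemma cint_split x a b phi : a <= x <= b -> cintegrable a b phi ->
  cint a b phi = cint a x phi + cint x b phi.
Proof.
move=> /andP[ax xb] [r i].
have H (f : R -> R) : mu.-integrable `[a, b] (EFin \o f) ->
    \int[mu]_(t in `[a, b]) f t =
    \int[mu]_(t in `[a, x]) f t + \int[mu]_(t in `[x, b]) f t.
  move=> fi; have := Rintegral_itvB fi.
  move=> /(_ x); rewrite !bnd_simp => /(_ ax xb) e.
  rewrite -[LHS](subrK (\int[mu]_(t in `[a, x]) f t)) e addrC; congr (_ + _).
  rewrite Rintegral_itv_obnd_cbnd//.
  apply: integrableS fi => //.
  by apply: subset_itv; rewrite bnd_simp.
by rewrite /cint (H _ r) (H _ i).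
Qed.

Lemma integrable_cst_itv (a b k : R) : mu.-integrable `[a, b] (EFin \o (fun=> k)).
Proof.
apply: continuous_compact_integrable; first exact: segment_compact.
by apply: continuous_subspaceT => t; exact: cst_continuous.
Qed.

Lemma Rintegral_itv_cst (a b k : R) : a <= b ->
  \int[mu]_(t in `[a, b]) k = k * (b - a).
Proof.
move=> ab; have := cint_cst k%:C ab; rewrite /cint.
by move=> /(congr1 (@complex.Re R))/= ->; rewrite mulr0 subr0.
Qed.

Lemma ge_Rintegral_itv (a b k : R) (f : R -> R) : a <= b ->
  mu.-integrable `[a, b] (EFin \o f) -> (forall t, a <= t <= b -> k <= f t) ->
  k * (b - a) <= \int[mu]_(t in `[a, b]) f t.
Proof.
move=> ab fi kf; rewrite -Rintegral_itv_cst//.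
by apply: le_Rintegral => //; exact: integrable_cst_itv.
Qed.

Lemma le_Rintegral_itv (a b k : R) (f : R -> R) : a <= b ->
  mu.-integrable `[a, b] (EFin \o f) -> (forall t, a <= t <= b -> f t <= k) ->
  \int[mu]_(t in `[a, b]) f t <= k * (b - a).
Proof.
move=> ab fi kf; rewrite -Rintegral_itv_cst//.
by apply: le_Rintegral => //; exact: integrable_cst_itv.
Qed.

(** The constant [2] comes from bounding real and imaginary part
    separately. *)
Lemma normc_cint_le a b phi (M : R) : a <= b -> cintegrable a b phi ->
  (forall t, a <= t <= b -> normc (phi t) <= M) ->
  normc (cint a b phi) <= 2 * M * (b - a).
Proof.
move=> ab [r i] phiM.
have H (f : R -> R) : mu.-integrable `[a, b] (EFin \o f) ->
    (forall t, `|f t| <= normc (phi t)) ->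
    `|\int[mu]_(t in `[a, b]) f t| <= M * (b - a).
  move=> fi fphi; apply: (le_trans (le_normr_Rintegral _ fi)) => //.
  apply: le_Rintegral_itv => //; first exact: integrable_norm.
  by move=> t /phiM; exact: le_trans.
apply: (le_trans (normc_le_ReIm _)); rewrite -mulrA mulr2n mulrDl mul1r.
by apply: lerD; apply: H => // t; [exact: ler_Re_normc|exact: ler_Im_normc].
Qed.

End complex_interval_integral.

(** * Contour integrals along rectangles *)

Section rectangle_integral.
Variable R : realType.
Local Open Scope complex_scope.
Local Notation C := R[i]^o.
Implicit Types (f g : C -> C) (c : R[i]) (x y : R).

Definition rect x0 x1 y0 y1 : set R[i] :=
  [set z | x0 <= reC z <= x1 /\ y0 <= imC z <= y1].

Definition rect_boundary x0 x1 y0 y1 : set R[i] :=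
  [set z | (x0 <= reC z <= x1 /\ (imC z = y0 \/ imC z = y1)) \/
           (y0 <= imC z <= y1 /\ (reC z = x0 \/ reC z = x1))].

Definition rintegrable f x0 x1 y0 y1 :=
  [/\ cintegrable x0 x1 (fun t => f (t +i* y0)),
      cintegrable x0 x1 (fun t => f (t +i* y1)),
      cintegrable y0 y1 (fun t => f (x0 +i* t)) &
      cintegrable y0 y1 (fun t => f (x1 +i* t))].

(** The contour integral of [f] along the boundary of the rectangle, in
    counterclockwise direction. *)
Definition rint f x0 x1 y0 y1 : R[i] :=
  (cint x0 x1 (fun t => f (t +i* y0)) - cint x0 x1 (fun t => f (t +i* y1))) +
  'i%C * (cint y0 y1 (fun t => f (x1 +i* t)) - cint y0 y1 (fun t => f (x0 +i* t))).

Lemma continuous_hcintegrable f (y a b : R) :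
  (forall t, a <= t <= b -> {for (t +i* y : C), continuous f}) ->
  cintegrable a b (fun t => f (t +i* y)).
Proof.
move=> fc; apply: continuous_cintegrable => t /fc /continuous_normcP H e /H.
move=> [d d0 Hd]; exists d => // s sd; apply: Hd.
have -> : (s +i* y) - (t +i* y) = (s - t)%:C :> R[i].
  by apply/eqP; rewrite eq_complex/= subrr !eqxx.
by rewrite normc_real.
Qed.

Lemma continuous_vcintegrable f (x a b : R) :
  (forall t, a <= t <= b -> {for (x +i* t : C), continuous f}) ->
  cintegrable a b (fun t => f (x +i* t)).
Proof.
move=> fc; apply: continuous_cintegrable => t /fc /continuous_normcP H e /H.
move=> [d d0 Hd]; exists d => // s sd; apply: Hd.
have -> : (x +i* s) - (x +i* t) = 'i%C * (s - t)%:C :> R[i].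
  by apply/eqP; rewrite eq_complex/= subrr !(mul0r,mul1r,oppr0,addr0,add0r)/= !eqxx.
by rewrite ComplexField.Normc.normcM normc_i mul1r normc_real.
Qed.

Lemma rect_boundary_edges (P : R[i] -> Prop) x0 x1 y0 y1 :
  (forall z, rect_boundary x0 x1 y0 y1 z -> P z) ->
  [/\ forall t, x0 <= t <= x1 -> P (t +i* y0),
      forall t, x0 <= t <= x1 -> P (t +i* y1),
      forall t, y0 <= t <= y1 -> P (x0 +i* t) &
      forall t, y0 <= t <= y1 -> P (x1 +i* t)].
Proof.
move=> H; split=> t ht; apply: H; rewrite /rect_boundary/=;
  first [by [left; split=> //; left]|by [left; split=> //; right]|
    by [right; split=> //; left]|by [right; split=> //; right]].
Qed.

Lemma subset_rect_boundary x0 x1 y0 y1 : x0 <= x1 -> y0 <= y1 ->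
  rect_boundary x0 x1 y0 y1 `<=` rect x0 x1 y0 y1.
Proof.
move=> x01 y01 z [[hx hy]|[hy hx]]; split => //.
- by case: hy => ->; rewrite lexx ?andbT.
- by case: hx => ->; rewrite lexx ?andbT.
Qed.

Lemma continuous_rintegrable f x0 x1 y0 y1 :
  (forall z, rect_boundary x0 x1 y0 y1 z -> {for z, continuous f}) ->
  rintegrable f x0 x1 y0 y1.
Proof.
move=> /rect_boundary_edges[fy0 fy1 fx0 fx1]; split.
- exact: continuous_hcintegrable fy0.
- exact: continuous_hcintegrable fy1.
- exact: continuous_vcintegrable fx0.
- exact: continuous_vcintegrable fx1.
Qed.

Lemma eq_rint f g x0 x1 y0 y1 :
  (forall z, rect_boundary x0 x1 y0 y1 z -> f z = g z) ->
  rint f x0 x1 y0 y1 = rint g x0 x1 y0 y1.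
Proof.
move=> /rect_boundary_edges[e1 e2 e3 e4]; rewrite /rint.
by rewrite (eq_cint e1) (eq_cint e2) (eq_cint e3) (eq_cint e4).
Qed.

Lemma rintB f g x0 x1 y0 y1 :
  rintegrable f x0 x1 y0 y1 -> rintegrable g x0 x1 y0 y1 ->
  rint (fun z => f z - g z) x0 x1 y0 y1 = rint f x0 x1 y0 y1 - rint g x0 x1 y0 y1.
Proof. by move=> [? ? ? ?] [? ? ? ?]; rewrite /rint !cintB//; ring. Qed.

Lemma rintZ c f x0 x1 y0 y1 : rintegrable f x0 x1 y0 y1 ->
  rint (fun z => c * f z) x0 x1 y0 y1 = c * rint f x0 x1 y0 y1.
Proof. by move=> [? ? ? ?]; rewrite /rint !cintZ//; ring. Qed.

Lemma rint_splitx x f x0 x1 y0 y1 : x0 <= x <= x1 ->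
  cintegrable x0 x1 (fun t => f (t +i* y0)) ->
  cintegrable x0 x1 (fun t => f (t +i* y1)) ->
  rint f x0 x1 y0 y1 = rint f x0 x y0 y1 + rint f x x1 y0 y1.
Proof.
move=> xx i0 i1.
by rewrite /rint (cint_split xx i0) (cint_split xx i1); ring.
Qed.

Lemma rint_splity y f x0 x1 y0 y1 : y0 <= y <= y1 ->
  cintegrable y0 y1 (fun t => f (x0 +i* t)) ->
  cintegrable y0 y1 (fun t => f (x1 +i* t)) ->
  rint f x0 x1 y0 y1 = rint f x0 x1 y0 y + rint f x0 x1 y y1.
Proof.
move=> yy i0 i1.
by rewrite /rint (cint_split yy i0) (cint_split yy i1); ring.
Qed.

Lemma normc_rint_le (M : R) f x0 x1 y0 y1 : x0 <= x1 -> y0 <= y1 ->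
  rintegrable f x0 x1 y0 y1 ->
  (forall z, rect_boundary x0 x1 y0 y1 z -> normc (f z) <= M) ->
  normc (rint f x0 x1 y0 y1) <= 4 * M * ((x1 - x0) + (y1 - y0)).
Proof.
move=> x01 y01 [i1 i2 i3 i4] /rect_boundary_edges[b1 b2 b3 b4].
have := normc_cint_le x01 i1 b1; have := normc_cint_le x01 i2 b2.
have := normc_cint_le y01 i3 b3; have := normc_cint_le y01 i4 b4.
rewrite /rint; set c1 := cint x0 x1 _; set c2 := cint x0 x1 _.
set c3 := cint y0 y1 _; set c4 := cint y0 y1 _ => h4 h3 h2 h1.
apply: (le_trans (normcD _ _)).
rewrite ComplexField.Normc.normcM normc_i mul1r.
by have := normcB c2 c1; have := normcB c3 c4; lra.
Qed.

(** The difference of the integrands along opposite edges is constant, so that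
    the horizontal and the vertical contribution can be computed and cancel. *)
Lemma rint_affine c c' x0 x1 y0 y1 : x0 <= x1 -> y0 <= y1 ->
  rintegrable (fun z => c + c' * z) x0 x1 y0 y1 ->
  rint (fun z => c + c' * z) x0 x1 y0 y1 = 0.
Proof.
move=> x01 y01 [i1 i2 i3 i4]; rewrite /rint -!cintB//.
have -> : (fun t : R => c + c' * (t +i* y0) - (c + c' * (t +i* y1))) =
          (fun=> c' * ('i%C * (y0 - y1)%:C)).
  apply/funext => t; rewrite opprD addrACA subrr add0r -mulrBr; congr (_ * _).
  by apply/eqP; rewrite eq_complex/= subrr !(mul0r,mul1r,mulr0,oppr0,addr0,add0r) !eqxx.
have -> : (fun t : R => c + c' * (x1 +i* t) - (c + c' * (x0 +i* t))) =
          (fun=> c' * (x1 - x0)%:C).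
  apply/funext => t; rewrite opprD addrACA subrr add0r -mulrBr; congr (_ * _).
  by apply/eqP; rewrite eq_complex/= subrr !eqxx.
rewrite !cint_cst// -(opprB y1 y0) rmorphN/=; ring.
Qed.

End rectangle_integral.

(** * Goursat's theorem for rectangles *)

Section goursat.
Variable R : realType.
Local Open Scope complex_scope.
Local Notation C := R[i]^o.

Lemma exists_expr_lt (q e : R) : 0 <= q < 1 -> 0 < e -> exists n, q ^+ n < e.
Proof.
move=> /andP[q0 q1] e0.
have /cvgrPdist_lt/(_ _ e0)[n _ H] : q ^+ n @[n --> \oo] --> (0 : R).
  by apply: cvg_expr; rewrite ger0_norm.
exists n; have := H n (leqnn n); rewrite /= sub0r normrN.
exact: le_lt_trans (ler_norm _).
Qed.

Lemma nested_intervals (x : nat -> R) (w : nat -> R) : (forall n, 0 <= w n) ->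
  (forall n, x n <= x n.+1) -> (forall n, x n.+1 + w n.+1 <= x n + w n) ->
  exists X, forall n, x n <= X <= x n + w n.
Proof.
move=> w0 xinc xwdec.
have xle n m : x n <= x (n + m)%N.
  by elim: m => [|m ih]; rewrite ?addn0// addnS (le_trans ih).
have xwle n m : x (n + m)%N + w (n + m)%N <= x n + w n.
  by elim: m => [|m ih]; rewrite ?addn0// addnS (le_trans _ ih).
have xxw n m : x n <= x m + w m.
  have [nm|/ltnW mn] := leqP n m.
    by rewrite (le_trans (xle n (m - n)%N))// subnKC// lerDl.
  by rewrite (le_trans _ (xwle m (n - m)%N))// subnKC// lerDl.
exists (sup (range x)) => n; apply/andP; split.
  by apply: ub_le_sup; [exists (x 0 + w 0) => _ [m _ <-]|exists n].
by apply: ge_sup; [exists (x 0), 0%N|move=> _ [m _ <-]].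
Qed.

(** [P n x y] stands for a property of the rectangle with lower left corner
    [(x, y)] and sides [w n] and [h n] that passes to one of its subrectangles
    of the next generation; the chosen rectangles shrink to the point [(X, Y)]
    when [w] and [h] tend to [0]. *)
Lemma bisection (P : nat -> R -> R -> Prop) (x y : R) (w h : nat -> R) :
  (forall n, 0 <= w n) -> (forall n, 0 <= h n) -> P 0%N x y ->
  (forall n x y, P n x y -> exists x' y', [/\ P n.+1 x' y',
    x <= x', x' + w n.+1 <= x + w n, y <= y' & y' + h n.+1 <= y + h n]) ->
  exists X Y, forall n, exists x' y', [/\ P n x' y',
    x' <= X <= x' + w n & y' <= Y <= y' + h n].
Proof.
move=> w0 h0 P0 PS.
pose T := {p : nat * (R * R) | P p.1 p.2.1 p.2.2}.
pose S (p q : T) := let: (n, (x, y)) := sval p in let: (n', (x', y')) := sval q in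
  [/\ n' = n.+1, x <= x', x' + w n.+1 <= x + w n, y <= y' &
      y' + h n.+1 <= y + h n].
have [|f [f0 fS]] := @dependent_choice T S _ (exist _ (0%N, (x, y)) P0).
  move=> [[n [a b]] Pab]; apply: cid.
  have [a' [b' [P' ? ? ? ?]]] := PS _ _ _ Pab.
  by exists (exist _ (n.+1, (a', b')) P').
pose u n := sval (f n).
have u1 n : (u n).1 = n.
  elim: n => [|n ih]; first by rewrite /u f0.
  have := fS n; rewrite /S -/(u n) -/(u n.+1); move: ih.
  by case: (u n) (u n.+1) => ? [? ?] [? [? ?]] /= -> [].
have uS n : [/\ (u n).2.1 <= (u n.+1).2.1,
    (u n.+1).2.1 + w n.+1 <= (u n).2.1 + w n, (u n).2.2 <= (u n.+1).2.2 &
      (u n.+1).2.2 + h n.+1 <= (u n).2.2 + h n].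
  have := fS n; rewrite /S -/(u n) -/(u n.+1); move: (u1 n).
  by case: (u n) (u n.+1) => ? [? ?] [? [? ?]] /= -> [].
have [X hX] : exists X, forall n, (u n).2.1 <= X <= (u n).2.1 + w n.
  by apply: nested_intervals => // n; have [] := uS n.
have [Y hY] : exists X, forall n, (u n).2.2 <= X <= (u n).2.2 + h n.
  by apply: nested_intervals => // n; have [] := uS n.
exists X, Y => n; exists (u n).2.1, (u n).2.2; split => //.
by have := svalP (f n); rewrite -/(u n) u1.
Qed.

Lemma normc_rect_le (x0 x1 y0 y1 : R) (z w : R[i]) :
  rect x0 x1 y0 y1 z -> rect x0 x1 y0 y1 w ->
  normc (z - w) <= (x1 - x0) + (y1 - y0).
Proof.
move=> [zx zy] [wx wy]; apply: (le_trans (normc_le_ReIm _)).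
move: z w zx zy wx wy => [a b] [c d] /= zx zy wx wy.
by apply: lerD; rewrite ler_norml; lra.
Qed.

Lemma affine_continuous (c c' : R[i]) (z : C) :
  {for z, continuous (fun w : C => c + c' * w : C)}.
Proof.
apply/continuous_normcP => e e0; exists (e / (normc c' + 1)).
  by rewrite divr_gt0// ltr_wpDl// normc_ge0.
move=> w; rewrite ltr_pdivlMr ?ltr_wpDl ?normc_ge0// => we.
have -> : c + c' * w - (c + c' * z) = c' * (w - z) by ring.
rewrite ComplexField.Normc.normcM (le_lt_trans _ we)// mulrC.
by rewrite ler_wpM2l ?normc_ge0// lerDl.
Qed.

Lemma rint_quarter (f : C -> C) (x y a b e : R) : 0 <= a -> 0 <= b ->
  rintegrable f x (x + a + a) y (y + b + b) ->
  rintegrable f x (x + a) y (y + b + b) ->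
  4 * e < normc (rint f x (x + a + a) y (y + b + b)) ->
  exists x' y', [/\ x' = x \/ x' = x + a, y' = y \/ y' = y + b &
    e < normc (rint f x' (x' + a) y' (y' + b))].
Proof.
move=> a0 b0 [i1 i2 i3 i4] [j1 j2 j3 j4].
have sx : x <= x + a <= x + a + a by apply/andP; lra.
have sy : y <= y + b <= y + b + b by apply/andP; lra.
rewrite (rint_splitx sx i1 i2) (rint_splity sy j3 j4) (rint_splity sy j4 i4).
have [b1|] := ltP e (normc (rint f x (x + a) y (y + b))).
  by exists x, y; split => //; left.
have [b2|] := ltP e (normc (rint f x (x + a) (y + b) (y + b + b))).
  by exists x, (y + b); split => //; [left|right].
have [b3|] := ltP e (normc (rint f (x + a) (x + a + a) y (y + b))).
  by exists (x + a), y; split => //; [right|left].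
have [b4|] := ltP e (normc (rint f (x + a) (x + a + a) (y + b) (y + b + b))).
  by exists (x + a), (y + b); split => //; right.
do 4 move: (rint _ _ _ _ _); move=> c1 c2 c3 c4 h1 h2 h3 h4.
rewrite ltNge => /negP[].
apply: (le_trans (normcD _ _)).
apply: (le_trans (lerD (normcD _ _) (normcD _ _))).
by lra.
Qed.

(** If the integral were nonzero, it would exceed [e * s ^+ 2] for some
    [e > 0], where [s] is the sum of the side lengths. As [s ^+ 2] drops to a
    quarter when the sides are halved, this inequality is inherited by one of
    the four quarters. At the point that the bisection converges to, [f] is
    affine up to a small multiple of the distance, and affine functions have
    vanishing contour integral, so the inequality fails for small
    rectangles. *)
Lemma goursat (f : C -> C) (x0 x1 y0 y1 : R) : x0 <= x1 -> y0 <= y1 ->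
  (forall z, rect x0 x1 y0 y1 z -> derivable f z 1) ->
  rint f x0 x1 y0 y1 = 0.
Proof.
move=> x01 y01 df.
have cf z : rect x0 x1 y0 y1 z -> {for z, continuous f}.
  by move=> /df /derivable_continuous.
have fi a b c d : x0 <= a -> a <= b -> b <= x1 -> y0 <= c -> c <= d -> d <= y1 ->
    rintegrable f a b c d.
  move=> *; apply: continuous_rintegrable => z zb; apply: cf.
  by have [//|//|/andP[? ?] /andP[? ?]] := subset_rect_boundary _ _ zb; split; lra.
apply/eqP; apply: contraT; rewrite -normc_gt0 => int0.
pose s : R := (x1 - x0) + (y1 - y0).
have s0 : 0 <= s by rewrite /s; lra.
pose e : R := normc (rint f x0 x1 y0 y1) / (s ^+ 2 + 1).
have s21 : 0 < s ^+ 2 + 1 by rewrite ltr_wpDl// sqr_ge0.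
have e0 : 0 < e by rewrite divr_gt0.
have es : e * s ^+ 2 < normc (rint f x0 x1 y0 y1).
  by rewrite /e mulrAC ltr_pdivrMr// ltr_pM2l// ltrDl.
pose w n : R := (x1 - x0) * 2^-1 ^+ n; pose h n : R := (y1 - y0) * 2^-1 ^+ n.
have q0 n : 0 <= 2^-1 ^+ n :> R by rewrite exprn_ge0.
have w0 n : 0 <= w n by rewrite mulr_ge0// subr_ge0.
have h0 n : 0 <= h n by rewrite mulr_ge0// subr_ge0.
pose P n x y := [/\ x0 <= x, x + w n <= x1, y0 <= y, y + h n <= y1 &
  e * (w n + h n) ^+ 2 < normc (rint f x (x + w n) y (y + h n))].
have [|n x y [xx0 xx1 yy0 yy1 big]|X [Y XY]] := @bisection P x0 y0 _ _ w0 h0.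
- rewrite /P /w /h expr0 !mulr1 !subrKC; split => //.
- have wS : w n = w n.+1 + w n.+1 by rewrite /w exprS; lra.
  have hS : h n = h n.+1 + h n.+1 by rewrite /h exprS; lra.
  move: xx1 yy1 big; rewrite wS hS !addrA; move: (w0 n.+1) (h0 n.+1).
  rewrite /P; move: (w n.+1) (h n.+1) => a b a0 b0 xx1 yy1 big.
  have {}big : 4 * (e * (a + b) ^+ 2) <
      normc (rint f x (x + a + a) y (y + b + b)).
    by rewrite [X in X < _](_ : _ = e * (a + a + b + b) ^+ 2)//; ring.
  have [||x' [y' [xx' yy' {}big]]] := rint_quarter a0 b0 _ _ big.
  + by clear big; apply: fi; lra.
  + by clear big; apply: fi; lra.
  + exists x', y'; suff : [/\ x0 <= x', x' + a <= x1, y0 <= y', y' + b <= y1 &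
      [/\ x <= x', x' + a <= x + a + a, y <= y' & y' + b <= y + b + b]].
      by move=> [? ? ? ? []]; split.
    by clear big; case: xx' yy' => -> [] ->; do 2 (split; try lra).
pose z := X +i* Y.
have [d Hd] : exists d, forall e : R, 0 < e -> exists2 r : R, 0 < r &
    forall w, normc (w - z) < r ->
      normc (f w - f z - d * (w - z)) <= e * normc (w - z).
  apply: derivable_normc; apply: df.
  have [x [y [[] + + + + _]]] := XY 0%N.
  by move=> ? ? ? ? /andP[? ?] /andP[? ?]; split=> /=; apply/andP; lra.
have [r r0 Hr] := Hd (e / 4) ltac:(by rewrite divr_gt0).
(* [s + 1] in place of [s], which may be [0] *)
have [n nr] : exists n, 2^-1 ^+ n < r / (s + 1) :> R.
  apply: exists_expr_lt; last by rewrite divr_gt0// ltr_wpDl.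
  by apply/andP; split; lra.
have {}nr : w n + h n < r.
  rewrite -mulrDl -/s; move: nr; rewrite ltr_pdivlMr ?ltr_wpDl// mulrC mulrDl mul1r.
  by have := q0 n; lra.
have [x [y [[xx0 xx1 yy0 yy1 big] xX yY]]] := XY n.
have := w0 n; have := h0 n; move: (w n) (h n) nr xx1 yy1 xX yY big.
move=> a b abr xx1 yy1 /andP[? ?] /andP[? ?] big b0 a0.
have zr : rect x (x + a) y (y + b) z by split; apply/andP.
have xa : x <= x + a by lra.
have yb : y <= y + b by lra.
have gi : rintegrable (fun w : C => f z - d * z + d * w) x (x + a) y (y + b).
  by apply: continuous_rintegrable => w' _; exact: affine_continuous.
have Fi : rintegrable f x (x + a) y (y + b) by apply: fi; lra.
move: big; rewrite ltNge; case/negP.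
(* subtract the tangent of [f] at [z], whose integral vanishes *)
rewrite -[rint f _ _ _ _]subr0 -(rint_affine xa yb gi) -rintB//.
have -> : e * (a + b) ^+ 2 =
    4 * (e / 4 * (a + b)) * ((x + a - x) + (y + b - y)) by field.
apply: normc_rint_le => //.
  apply: continuous_rintegrable => w' wb.
  apply: (@continuousB _ _ _ f (fun w : C => f z - d * z + d * w)).
    apply: cf; have [/andP[? ?] /andP[? ?]] := subset_rect_boundary xa yb wb.
    by split; apply/andP; lra.
  exact: affine_continuous.
move=> w' wb.
have wz : normc (w' - z) <= a + b.
  have := normc_rect_le (subset_rect_boundary xa yb wb) zr.
  by rewrite [X in _ <= X -> _](_ : _ = a + b)//; ring.
have -> : f w' - (f z - d * z + d * w') = f w' - f z - d * (w' - z) by ring.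
apply: (le_trans (Hr _ (le_lt_trans wz abr))).
by rewrite ler_wpM2l// divr_ge0// ltW.
Qed.

End goursat.

(** * Cauchy's integral formula for rectangles *)

Section cauchy.
Variable R : realType.
Local Open Scope complex_scope.
Local Notation C := R[i]^o.
Local Notation mu := (@lebesgue_measure R).

(** Cutting along the lines that bound the square leaves, besides the square
    itself, four rectangles that avoid [a]. *)
Lemma rint_shrink (F : C -> C) (a : R[i]) (x0 x1 y0 y1 d : R) : 0 < d ->
  x0 <= reC a - d -> reC a + d <= x1 -> y0 <= imC a - d -> imC a + d <= y1 ->
  (forall z, rect x0 x1 y0 y1 z -> z != a -> derivable F z 1) ->
  rint F x0 x1 y0 y1 =
  rint F (reC a - d) (reC a + d) (imC a - d) (imC a + d).
Proof.
case: a => u v /= d0 xu ux yv vy dF.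
have dF' z : rect x0 x1 y0 y1 z -> reC z != u \/ imC z != v -> derivable F z 1.
  move=> zr zn; apply: dF => //; rewrite eq_complex negb_and /=.
  by case: zn => ->; rewrite ?orbT.
have cF z : rect x0 x1 y0 y1 z -> reC z != u \/ imC z != v ->
    {for z, continuous F}.
  by move=> zr zn; apply: derivable_continuous; apply: dF'.
have hi (y b c : R) : x0 <= b -> c <= x1 -> y0 <= y <= y1 -> y != v ->
    cintegrable b c (fun t => F (t +i* y)).
  move=> xb cx yy yn; apply: continuous_hcintegrable => t /andP[bt tc].
  by apply: cF; [split=> //=; apply/andP; lra|right].
have vi (x b c : R) : y0 <= b -> c <= y1 -> x0 <= x <= x1 -> x != u ->
    cintegrable b c (fun t => F (x +i* t)).
  move=> xb cx yy yn; apply: continuous_vcintegrable => t /andP[bt tc].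
  by apply: cF; [split=> //=; apply/andP; lra|left].
have xuN : u - d != u by rewrite lt_eqF// ltrBlDr ltrDl.
have xuP : u + d != u by rewrite gt_eqF// ltrDl.
have yvN : v - d != v by rewrite lt_eqF// ltrBlDr ltrDl.
have yvP : v + d != v by rewrite gt_eqF// ltrDl.
have y0N : y0 != v by rewrite lt_eqF//; lra.
have y1N : y1 != v by rewrite gt_eqF//; lra.
rewrite (@rint_splitx _ (u - d)); first last.
- by apply: hi => //; first [lra|apply/andP; lra].
- by apply: hi => //; first [lra|apply/andP; lra].
- by apply/andP; lra.
rewrite goursat ?add0r; [|lra|lra|]; last first.
  move=> z [/andP[xz zx] yz]; apply: dF'; first by split => //; apply/andP; lra.
  by left; rewrite lt_eqF//; lra.
rewrite (@rint_splitx _ (u + d)); first last.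
- by apply: hi => //; first [lra|apply/andP; lra].
- by apply: hi => //; first [lra|apply/andP; lra].
- by apply/andP; lra.
rewrite [X in _ + X]goursat ?addr0; [|lra|lra|]; last first.
  move=> z [/andP[xz zx] yz]; apply: dF'; first by split => //; apply/andP; lra.
  by left; rewrite gt_eqF//; lra.
rewrite (@rint_splity _ (v - d)); first last.
- by apply: vi => //; first [lra|apply/andP; lra].
- by apply: vi => //; first [lra|apply/andP; lra].
- by apply/andP; lra.
rewrite goursat ?add0r; [|lra|lra|]; last first.
  move=> z [/andP[xz zx] /andP[yz zy]]; apply: dF'.
    by split => //; apply/andP; lra.
  by right; rewrite lt_eqF//; lra.
rewrite (@rint_splity _ (v + d)); first last.
- by apply: vi => //; first [lra|apply/andP; lra].
- by apply: vi => //; first [lra|apply/andP; lra].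
- by apply/andP; lra.
rewrite [X in _ + X]goursat ?addr0; [by []|lra|lra|].
move=> z [/andP[xz zx] /andP[yz zy]]; apply: dF'.
  by split => //; apply/andP; lra.
by right; rewrite gt_eqF//; lra.
Qed.

Definition in_rect (x0 x1 y0 y1 : R) (a : R[i]) :=
  x0 < reC a < x1 /\ y0 < imC a < y1.

Lemma rect_boundary_neq (x0 x1 y0 y1 : R) (a z : R[i]) :
  in_rect x0 x1 y0 y1 a -> rect_boundary x0 x1 y0 y1 z -> z != a.
Proof.
move=> [/andP[xa ax] /andP[ya ay]] zb; apply/eqP => za; subst z.
by case: zb => [[_ []]|[_ []]] e; move: e xa ax ya ay => ->; rewrite ltxx.
Qed.

(** The integral equals that along a square with centre [a] and half side [d],
    whose length tends to [0] with [d] while the integrand stays bounded. *)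
Lemma rint_removable (F : C -> C) (a : R[i]) (x0 x1 y0 y1 K r : R) :
  in_rect x0 x1 y0 y1 a -> 0 < r ->
  (forall z, rect x0 x1 y0 y1 z -> z != a -> derivable F z 1) ->
  (forall z, z != a -> normc (z - a) < r -> normc (F z) <= K) ->
  rint F x0 x1 y0 y1 = 0.
Proof.
move=> ain r0 dF FK; apply/eqP; apply: contraT; rewrite -normc_gt0.
set I := normc _ => I0.
have [/andP[xa ax] /andP[ya ay]] := ain.
have K10 : 0 < 32 * (`|K| + 1) by rewrite mulr_gt0// ltr_wpDl.
(* The boundary of the square stays within distance [4 * d] of [a], and the
   integral along it is at most [16 * K * d]. *)
have [d [[d0 dr dI] [d1 d2 d3 d4]]] : exists d : R, [/\ 0 < d, 8 * d <= r &
    d * (32 * (`|K| + 1)) <= I] /\ [/\ d <= reC a - x0, d <= x1 - reC a,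
    d <= imC a - y0 & d <= y1 - imC a].
  pose m := Num.min (Num.min (r / 8) (I / (32 * (`|K| + 1))))
    (Num.min (Num.min (reC a - x0) (x1 - reC a))
             (Num.min (imC a - y0) (y1 - imC a))).
  have m0 : 0 < m by rewrite /m !lt_min !subr_gt0 xa ax ya ay !divr_gt0.
  have : m <= m by []; rewrite {2}/m !le_min ler_pdivlMr//.
  move=> /andP[/andP[m1 m2] /andP[/andP[m3 m4] /andP[m5 m6]]].
  exists m; split; split; [exact: m0|by rewrite mulrC|by rewrite -ler_pdivlMr|
    exact: m3|exact: m4|exact: m5|exact: m6].
have e : rint F x0 x1 y0 y1 = rint F (reC a - d) (reC a + d) (imC a - d) (imC a + d).
  by apply: rint_shrink dF => //; lra.
have ain' : in_rect (reC a - d) (reC a + d) (imC a - d) (imC a + d) a.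
  by split; apply/andP; lra.
have axd : reC a - d <= reC a + d by lra.
have ayd : imC a - d <= imC a + d by lra.
suff : I <= 4 * (`|K| + 1) * ((reC a + d - (reC a - d)) + (imC a + d - (imC a - d))).
  move=> II; have : d * (32 * (`|K| + 1)) <= d * (16 * (`|K| + 1)) by lra.
  by rewrite ler_pM2l// ler_pM2r ?ltr_wpDl//; lra.
rewrite /I e; apply: normc_rint_le => //.
  apply: continuous_rintegrable => z zb; apply: derivable_continuous.
  apply: dF; last exact: rect_boundary_neq ain' zb.
  have [/andP[? ?] /andP[? ?]] := subset_rect_boundary axd ayd zb.
  by split; apply/andP; lra.
move=> z zb; apply: (@le_trans _ _ K); last first.
  by rewrite (le_trans (ler_norm _))// lerDl.
apply: FK; first exact: rect_boundary_neq ain' zb.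
have ra : rect (reC a - d) (reC a + d) (imC a - d) (imC a + d) a.
  by split; apply/andP; lra.
have := normc_rect_le (subset_rect_boundary axd ayd zb) ra; lra.
Qed.

Lemma derivable_subC (c z : C) : derivable (fun w : C => w - c : C) z 1.
Proof. by apply: derivableB; [exact: derivable_id|exact: derivable_cst]. Qed.

Lemma derivable_inv_subC (a z : C) : z != a ->
  derivable (fun w : C => (w - a)^-1 : C) z 1.
Proof.
move=> za; apply: (@derivableV _ _ (fun w : C => w - a : C) z 1).
  by rewrite subr_eq0.
exact: derivable_subC.
Qed.

Lemma derivable_div_subC (h : C -> C) (a z : C) : z != a -> derivable h z 1 ->
  derivable (fun w : C => h w / (w - a) : C) z 1.
Proof.
move=> za dh; apply: (@derivableM _ _ h (fun w : C => (w - a)^-1 : C) z 1 dh).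
exact: derivable_inv_subC.
Qed.

Lemma rect_of_boundary (x0 x1 y0 y1 : R) (a z : R[i]) :
  in_rect x0 x1 y0 y1 a -> rect_boundary x0 x1 y0 y1 z -> rect x0 x1 y0 y1 z.
Proof.
move=> [/andP[? ?] /andP[? ?]]; by apply: subset_rect_boundary; lra.
Qed.

(** The difference quotient [(h z - h a) / (z - a)] is bounded near [a], so
    its contour integral vanishes. The integral on the right has the value
    [2 * pi * i]; what matters below is that it is nonzero
    ([rint_inv_neq0]). *)
Lemma cauchy_formula (h : C -> C) (a : R[i]) (x0 x1 y0 y1 : R) :
  in_rect x0 x1 y0 y1 a ->
  (forall z, rect x0 x1 y0 y1 z -> derivable h z 1) ->
  rint (fun z => h z / (z - a)) x0 x1 y0 y1 =
  h a * rint (fun z => (z - a)^-1) x0 x1 y0 y1.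
Proof.
move=> ain dh; apply/eqP; rewrite -subr_eq0; apply/eqP.
have inb z : rect_boundary x0 x1 y0 y1 z -> rect x0 x1 y0 y1 z /\ z != a.
  by move=> zb; split; [exact: rect_of_boundary ain zb|exact: rect_boundary_neq ain zb].
have ii : rintegrable (fun z : C => (z - a)^-1 : C) x0 x1 y0 y1.
  apply: continuous_rintegrable => z /inb[zr za]; apply: derivable_continuous.
  exact: derivable_inv_subC.
have hi : rintegrable (fun z : C => h z / (z - a) : C) x0 x1 y0 y1.
  apply: continuous_rintegrable => z /inb[zr za]; apply: derivable_continuous.
  by apply: derivable_div_subC => //; exact: dh.
have hi' : rintegrable (fun z : C => h a * (z - a)^-1 : C) x0 x1 y0 y1.
  apply: continuous_rintegrable => z /inb[zr za]; apply: derivable_continuous.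
  by apply: derivable_div_subC => //; exact: derivable_cst.
rewrite -rintZ// -rintB//.
rewrite -(@eq_rint _ (fun z : C => (h z - h a) / (z - a) : C)); last first.
  by move=> z _; rewrite mulrBl.
have ar : rect x0 x1 y0 y1 a.
  by case: ain => /andP[? ?] /andP[? ?]; split; apply/andP; split; exact: ltW.
have [d /(_ 1 ltr01)[r r0 Hr]] := derivable_normc (dh _ ar).
apply: (@rint_removable _ a _ _ _ _ (normc d + 1) r) => //.
  move=> z zr za; apply: (@derivable_div_subC (fun w => h w - h a)) => //.
  by apply: derivableB; [exact: dh|exact: derivable_cst].
move=> z za zr; have za0 : 0 < normc (z - a) by rewrite normc_gt0 subr_eq0.
rewrite ComplexField.Normc.normcM ComplexField.Normc.normcV ler_pdivrMr//.
have -> : h z - h a = d * (z - a) + (h z - h a - d * (z - a)) by ring.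
apply: (le_trans (normcD _ _)); rewrite ComplexField.Normc.normcM mulrDl lerD2l.
exact: Hr.
Qed.

(** Each edge, traversed counterclockwise, contributes a nonnegative amount to
    the imaginary part of the integral, and the lower one a positive amount,
    since the imaginary part of its integrand is bounded away from [0]. *)
Lemma rint_inv_neq0 (a : R[i]) (x0 x1 y0 y1 : R) : in_rect x0 x1 y0 y1 a ->
  rint (fun z : C => (z - a)^-1 : C) x0 x1 y0 y1 != 0.
Proof.
move=> ain.
have [[i1 i1'] [i2 i2'] [i3 i3'] [i4 i4']] :
    rintegrable (fun z : C => (z - a)^-1 : C) x0 x1 y0 y1.
  apply: continuous_rintegrable => z zb; apply: derivable_continuous.
  apply: derivable_inv_subC; exact: rect_boundary_neq ain zb.
suff : 0 < imC (rint (fun z : C => (z - a)^-1 : C) x0 x1 y0 y1).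
  by apply: contraTneq => ->; rewrite ltxx.
case: a ain i1 i1' i2 i2' i3 i3' i4 i4' => u v [/= /andP[xu ux] /andP[yv vy]].
move=> i1 i1' i2 i2' i3 i3' i4 i4'.
have x01 : x0 <= x1 by lra.
have y01 : y0 <= y1 by lra.
pose L : R := (x1 - x0) ^+ 2 + (v - y0) ^+ 2.
have L0 : 0 < L.
  by apply: ltr_wpDl; [exact: sqr_ge0|rewrite exprn_gt0// subr_gt0].
have k0 : 0 < (v - y0) / L * (x1 - x0).
  by rewrite mulr_gt0 ?divr_gt0// subr_gt0//; lra.
have h1 := ge_Rintegral_itv (k := (v - y0) / L) x01 i1'.
have h2 := le_Rintegral_itv (k := 0) x01 i2'.
have h3 := le_Rintegral_itv (k := 0) y01 i3.
have h4 := ge_Rintegral_itv (k := 0) y01 i4.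
have {}h1 : (v - y0) / L * (x1 - x0) <=
    \int[mu]_(t in `[x0, x1]) - ((y0 - v) / ((t - u) ^+ 2 + (y0 - v) ^+ 2)).
  apply: h1 => t /andP[xt tx]; rewrite -mulNr opprB.
  have -> : (y0 - v) ^+ 2 = (v - y0) ^+ 2 by ring.
  have vy2 : 0 < (v - y0) ^+ 2 by rewrite exprn_gt0// subr_gt0.
  rewrite ler_wpM2l ?subr_ge0 ?(ltW yv)// lef_pV2 ?posrE//; last first.
    by rewrite ltr_wpDl// sqr_ge0.
  rewrite /L lerD2r -ler_sqrt ?sqr_ge0// !sqrtr_sqr.
  by rewrite [leRHS]ger0_norm ?ler_norml; lra.
have {}h2 : \int[mu]_(t in `[x0, x1])
    - ((y1 - v) / ((t - u) ^+ 2 + (y1 - v) ^+ 2)) <= 0.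
  rewrite -[leRHS](mul0r (x1 - x0)); apply: h2 => t _.
  by rewrite oppr_le0 divr_ge0 ?subr_ge0 ?(ltW vy)// addr_ge0 ?sqr_ge0.
have {}h3 : \int[mu]_(t in `[y0, y1])
    ((x0 - u) / ((x0 - u) ^+ 2 + (t - v) ^+ 2)) <= 0.
  rewrite -[leRHS](mul0r (y1 - y0)); apply: h3 => t _.
  by rewrite mulr_le0_ge0 ?subr_le0 ?(ltW xu)// invr_ge0 addr_ge0 ?sqr_ge0.
have {}h4 : 0 <= \int[mu]_(t in `[y0, y1])
    ((x1 - u) / ((x1 - u) ^+ 2 + (t - v) ^+ 2)).
  rewrite -[leLHS](mul0r (y1 - y0)); apply: h4 => t _.
  by rewrite divr_ge0 ?subr_ge0 ?(ltW ux)// addr_ge0 ?sqr_ge0.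
rewrite /rint /cint/= mul0r mul1r add0r.
apply: (lt_le_trans k0); rewrite -[leLHS]addr0; apply: lerD.
  by rewrite -[leLHS]subr0; apply: lerB.
by rewrite -(subr0 0); apply: lerB.
Qed.

End cauchy.

(** * Holomorphic functions with infinitely many zeros near a point *)

Section many_zeros.
Variable R : realType.
Local Open Scope complex_scope.
Local Notation C := R[i]^o.
Variables (h : C -> C) (p r M : R).
Hypothesis r0 : 0 < r.
Hypothesis dh : forall z, rect (p - r) (p + r) (- r) r z -> derivable h z 1.
Hypothesis hM : forall z, rect (p - r) (p + r) (- r) r z -> normc (h z) <= M.

(** Points that are [near] have mutual distance less than [r / 2], whereas
    their distance to the boundary of the square is at least [r * (3 / 4)]. *)
Let near t := `|t - p| < r / 4.

Local Notation contour f := (rint f (p - r) (p + r) (- r) r).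

Lemma near_in_rect t : near t -> in_rect (p - r) (p + r) (- r) r t%:C.
Proof. by rewrite /near ltr_norml => /andP[? ?]; split => /=; apply/andP; lra. Qed.

Lemma near_dist_boundary t z : near t ->
  rect_boundary (p - r) (p + r) (- r) r z -> r * (3 / 4) <= normc (z - t%:C).
Proof.
have rp := r0; rewrite /near ltr_norml => /andP[t1 t2] zb.
have er : reC (z - t%:C) = reC z - t by case: z {zb}.
have ei : imC (z - t%:C) = imC z by case: z {er zb} => x y /=; rewrite subr0.
case: zb => [[_ hy]|[_ hx]].
  apply: le_trans (ler_Im_normc _); rewrite ei.
  by case: hy => ->; rewrite ?normrN ger0_norm; lra.
apply: le_trans (ler_Re_normc _); rewrite er.
by case: hx => ->; [rewrite ler0_norm|rewrite ger0_norm]; lra.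
Qed.

Section interpolation.
Variable a : nat -> R.
Hypothesis a_inj : injective a.
Hypothesis a_near : forall n, near (a n).
Hypothesis ha : forall n, h (a n)%:C = 0.

Let W n (z : C) : C := \prod_(k < n) (z - (a k)%:C).

Let derivable_W n (z : C) : derivable (W n) z 1.
Proof.
elim: n => [|n ih].
  rewrite (_ : W 0 = cst 1); first exact: derivable_cst.
  by apply/funext => w; rewrite /W big_ord0.
rewrite (_ : W n.+1 = W n * (fun w : C => w - (a n)%:C : C)).
  apply: (@derivableM _ _ (W n) (fun w : C => w - (a n)%:C : C) z 1 ih).
  exact: derivable_subC.
by apply/funext => w; rewrite /W big_ord_recr.
Qed.

Let sub_neq0 t z : near t -> rect_boundary (p - r) (p + r) (- r) r z ->
  z - t%:C != 0.
Proof.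
move=> nt zb; rewrite -normc_gt0; apply: lt_le_trans (near_dist_boundary nt zb).
by rewrite mulr_gt0// divr_gt0.
Qed.

Let W_neq0 n z : rect_boundary (p - r) (p + r) (- r) r z -> W n z != 0.
Proof.
by move=> zb; rewrite /W prodf_seq_neq0; apply/allP => k _ /=; exact: sub_neq0.
Qed.

Let G n b (z : C) : C := h z / W n z / (z - b%:C).

Let G_integrable n b : near b -> rintegrable (G n b) (p - r) (p + r) (- r) r.
Proof.
move=> nb; apply: continuous_rintegrable => z zb; apply: derivable_continuous.
apply: derivable_div_subC; first by rewrite -subr_eq0; exact: sub_neq0 zb.
apply: (@derivableM _ _ h (fun z : C => (W n z)^-1 : C)).
  by apply: dh; exact: rect_of_boundary (near_in_rect nb) zb.
by apply: derivableV; [exact: W_neq0|exact: derivable_W].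
Qed.

(** Dividing [h] by the linear factors of its zeros one after the other: by
    the formula for [n] zeros the contour integral of [G n b] vanishes at the
    next zero, hence the partial fraction decomposition of
    [(z - b)^-1 * (z - a n)^-1] yields the formula for [n.+1] zeros. *)
Lemma cauchy_interpolation n b : near b ->
  h b%:C * contour (fun z => (z - b%:C)^-1) = W n b%:C * contour (G n b).
Proof.
elim: n b => [|n ih] b nb.
  rewrite -cauchy_formula//; last exact: near_in_rect.
  rewrite /W big_ord0 mul1r; apply: eq_rint => z _.
  by rewrite /G /W big_ord0 divr1.
have an0 : contour (G n (a n)) = 0.
  have /esym/eqP := ih _ (a_near n); rewrite ha mul0r mulf_eq0 => /orP[|/eqP//].
  rewrite /W prodf_seq_eq0 => /hasP[k _ /=]; rewrite subr_eq0 => /eqP.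
  by move=> /complexI/a_inj/eqP; rewrite gtn_eqF.
rewrite ih// -[contour (G n b)]subr0 -an0 -rintB; try exact: G_integrable.
rewrite /W big_ord_recr/= -/(W n b%:C) -mulrA; congr (_ * _).
rewrite -rintZ; last exact: G_integrable.
apply: eq_rint => z zb; rewrite /G {3}/W big_ord_recr/= -/(W n z).
have := W_neq0 n zb; have := sub_neq0 nb zb; have := sub_neq0 (a_near n) zb.
by move=> z1 z2 z3; field; rewrite z1 z2 z3.
Qed.

Let M0 : 0 <= M.
Proof.
have rp := r0; apply: le_trans (normc_ge0 (h p%:C)) (hM _).
by split => /=; apply/andP; lra.
Qed.

(** In the interpolation formula the factor [W n b] is at most
    [(r / 2) ^+ n], and the integrand is at most a constant times
    [(r * (3 / 4)) ^- n]. The quotient [2 / 3] of the two bases makes the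
    product tend to [0]. *)
Lemma sequence_of_zeros b : near b -> h b%:C = 0.
Proof.
move=> nb; have rp := r0.
have k0 := rint_inv_neq0 (near_in_rect nb).
apply/eqP; rewrite -[_ == 0](mulIr_eq0 _ (mulIf k0)); apply: contraT.
rewrite -normc_gt0; set I := normc _ => I0.
pose K := 4 * (M / (r * (3 / 4))) * ((p + r - (p - r)) + (r - - r)).
have r34 : 0 < r * (3 / 4) by rewrite mulr_gt0// divr_gt0.
have K0 : 0 <= K.
  by rewrite /K mulr_ge0// ?mulr_ge0// ?mulr_ge0// ?invr_ge0 ?(ltW r34)//; lra.
have IK n : I <= K * (2 / 3) ^+ n.
  rewrite /I (cauchy_interpolation n nb) ComplexField.Normc.normcM.
  have h1 : normc (W n b%:C) <= (r / 2) ^+ n.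
    rewrite /W normc_prod -[X in _ ^+ X]card_ord -prodr_const.
    apply: ler_prod => k _; rewrite normc_ge0 andTb.
    rewrite [X in normc X](_ : _ = (b - a k)%:C); last first.
      by apply/eqP; rewrite eq_complex/= subrr !eqxx.
    rewrite normc_real.
    move: nb (a_near k); rewrite /near !ltr_norml => /andP[? ?] /andP[? ?].
    by rewrite ler_norml; lra.
  have h2 : normc (contour (G n b)) <=
      4 * (M / (r * (3 / 4)) ^+ n / (r * (3 / 4))) *
      ((p + r - (p - r)) + (r - - r)).
    apply: normc_rint_le; [lra|lra|exact: G_integrable|move=> z zb].
    rewrite /G !ComplexField.Normc.normcM !ComplexField.Normc.normcV.
    rewrite ler_pM ?mulr_ge0 ?invr_ge0 ?normc_ge0//; last first.
      rewrite lef_pV2 ?posrE ?normc_gt0 ?sub_neq0//.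
      exact: near_dist_boundary.
    rewrite ler_pM ?invr_ge0 ?normc_ge0//.
      by apply: hM; exact: rect_of_boundary (near_in_rect nb) zb.
    rewrite lef_pV2 ?posrE ?exprn_gt0 ?normc_gt0 ?W_neq0//.
    rewrite /W normc_prod -[X in _ ^+ X]card_ord -prodr_const.
    apply: ler_prod => k _; rewrite (ltW r34) andTb.
    exact: near_dist_boundary.
  apply: (le_trans (ler_pM _ _ h1 h2)); rewrite ?normc_ge0//.
  have -> : (2 / 3 : R) ^+ n = (r / 2) ^+ n / (r * (3 / 4)) ^+ n.
    by rewrite -expr_div_n; congr (_ ^+ _); field; lra.
  rewrite /K le_eqVlt; apply/orP; left; apply/eqP; field.
  by rewrite expf_neq0 ?gt_eqF.
have [n] : exists n, (2 / 3) ^+ n < I / (K + 1).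
  by apply: exists_expr_lt; [apply/andP; lra|rewrite divr_gt0// ltr_wpDl].
rewrite ltr_pdivlMr ?ltr_wpDl// => In.
have q0 : 0 < (2 / 3 : R) ^+ n by rewrite exprn_gt0//; lra.
by have := IK n; rewrite mulrDr mulr1 in In; lra.
Qed.

End interpolation.

Lemma infinitely_many_zeros : infinite_set [set t | near t /\ h t%:C = 0] ->
  forall t, near t -> h t%:C = 0.
Proof.
move=> /infiniteP /pcard_leP /injfunPex[/= a aP a_inj] t nt.
apply: (@sequence_of_zeros a) => //.
- by move=> m n; apply: a_inj; rewrite inE.
- by move=> n; have [] := aP n Logic.I.
- by move=> n; have [] := aP n Logic.I.
Qed.

End many_zeros.

(** * The identity theorem on an interval *)

Section one_variable.
Variable R : realType.
Local Open Scope complex_scope.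
Local Notation C := R[i]^o.
Implicit Types (I : set R) (f : R -> R).

(** The holomorphic extension is defined and bounded on a square with centre
    [p], so that [infinitely_many_zeros] applies to it. *)
Lemma extendable_local I f (p : R) : holomorphically_extendable I f -> I p ->
  exists2 d : R, 0 < d &
    infinite_set [set t | `|t - p| < d /\ (I t /\ f t = 0)] ->
    forall t, `|t - p| < d -> I t -> f t = 0.
Proof.
move=> [U [h [oU hU IU hf]]] Ip.
have Up := IU _ Ip.
have [d1 d10 Ud1] : exists2 d : R, 0 < d &
    forall z, normc (z - p%:C) < d -> U z.
  have /nbhs_ballP [d /= d0 H] := open_nbhs_nbhs (conj oU Up).
  move: d d0 H => [d d']; rewrite ltcE/= => /andP[/eqP -> d0] H.
  exists d => // w wd; apply: H.
  by rewrite /ball/= distrC normCE ltcR.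
have /continuous_normcP /(_ 1 ltr01)[d2 d20 hd2] :=
  derivable_continuous (hU _ Up).
(* The points of the square with half side [r] have distance at most [4 * r]
   from its centre. *)
pose r : R := Num.min d1 d2 / 8.
have r0 : 0 < r by rewrite divr_gt0// lt_min d10 d20.
have [rd1 rd2] : r * 8 <= d1 /\ r * 8 <= d2.
  by rewrite /r divfK// !ge_min !lexx orbT.
clearbody r.
have pr : rect (p - r) (p + r) (- r) r p%:C by split => /=; apply/andP; lra.
have near_p z : rect (p - r) (p + r) (- r) r z -> normc (z - p%:C) < 8 * r.
  by move=> /normc_rect_le /(_ pr); lra.
have dh z : rect (p - r) (p + r) (- r) r z -> derivable h z 1.
  by move=> /near_p zp; apply: hU; apply: Ud1; lra.
have hM z : rect (p - r) (p + r) (- r) r z -> normc (h z) <= normc (h p%:C) + 1.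
  move=> /near_p zp; have /hd2 : normc (z - p%:C) < d2 by lra.
  by have := normcD (h z - h p%:C) (h p%:C); rewrite subrK; lra.
exists (r / 4); first by rewrite divr_gt0.
move=> inf t tp It; have : h t%:C = 0.
  apply: (infinitely_many_zeros r0 dh hM) => //.
  apply: sub_infinite_set inf => s [sp [Is fs]]; split => //.
  by rewrite hf// fs.
by rewrite hf// => -[].
Qed.

Lemma infinite_itvoo (a b : R) : a < b -> infinite_set `]a, b[%classic.
Proof.
move=> ab /finite_set_countable /countable_lebesgue_measure0.
rewrite lebesgue_measure_itv/= lte_fin ab => -[] /eqP.
by rewrite subr_eq0 gt_eqF.
Qed.

(** The set of points with a neighbourhood on which [f] vanishes is open and
    closed in the interval [I]. If it is empty then the zeros of [f] are
    isolated, and hence countably many. *)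
Lemma extendable_eq0 I f : open I -> is_interval I ->
  holomorphically_extendable I f ->
  ~ countable [set t | I t /\ f t = 0] -> forall t, I t -> f t = 0.
Proof.
move=> oI iI ext unc.
pose Z := [set t | I t /\ f t = 0].
have ZI : Z `<=` I by move=> t [].
suff ZE : Z° = I.
  move=> t It; have Zt : Z° t by rewrite ZE.
  by have [] := interior_subset Zt.
move/connected_intervalP : iI; apply.
- apply: contrapT => /nonemptyPn Z0; apply: unc.
  (* Only countably many intervals with rational endpoints are needed to cover
     [Z] by intervals with finitely many zeros. *)
  pose D := [set q : rat * rat | finite_set (Z `&` `]ratr q.1, ratr q.2[%classic)].
  have -> : [set t | I t /\ f t = 0] =
      \bigcup_(q in D) (Z `&` `]ratr q.1, ratr q.2[%classic).
    apply/seteqP; split => [t Zt|t [q _ []]//].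
    have [d d0 Hd] := extendable_local ext (ZI _ Zt).
    have [q1] := @rat_in_itvoo R (t - d) t ltac:(lra).
    have [q2] := @rat_in_itvoo R t (t + d) ltac:(lra).
    rewrite !in_itv/= => /andP[q2t tq2] /andP[q1t tq1].
    exists (q1, q2); last by split => //=; rewrite in_itv/= tq1 q2t.
    rewrite /D/=; apply: contrapT => inf.
    have fd : forall s, `|s - t| < d -> I s -> f s = 0.
      apply: Hd; apply: sub_infinite_set inf => s [[Is fs] /=].
      rewrite in_itv/= => /andP[? ?]; split => //.
      by rewrite ltr_norml; apply/andP; lra.
    suff : Z° t by rewrite Z0.
    have nI : nbhs t I := open_nbhs_nbhs (conj oI (ZI _ Zt)).
    have nd : nbhs t [set s | `|s - t| < d].
      by apply/nbhs_ballP; exists d => //= s; rewrite /ball/= distrC.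
    by apply: filterS (filterI nI nd) => s [Is sd]; split => //; exact: fd.
  apply: bigcup_countable => //.
  by move=> q; exact: finite_set_countable.
- exists Z°; first exact: open_interior.
  by apply/seteqP; split => [t Zt|t []//]; split => //; exact: ZI (interior_subset Zt).
- exists (closure Z°); first exact: closed_closure.
  apply/seteqP; split => [t Zt|t [It cZ]].
    by split; [exact: ZI (interior_subset Zt)|exact: subset_closure].
  have [d d0 Hd] := extendable_local ext It.
  have nd : nbhs t [set s | `|s - t| < d].
    by apply/nbhs_ballP; exists d => //= s; rewrite /ball/= distrC.
  have [s [Zs sd]] := cZ _ nd.
  have fd : forall s, `|s - t| < d -> I s -> f s = 0.
    apply: Hd; move: Zs => /nbhs_ballP[e /= e0 eZ].
    (* an interval that consists of zeros and lies in the ball around [t] *)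
    pose e' := Num.min e (d - `|s - t|).
    have e'0 : 0 < e' by rewrite lt_min e0 subr_gt0.
    have := @infinite_itvoo s (s + e') ltac:(by rewrite ltrDl).
    apply: sub_infinite_set => u /=; rewrite in_itv/= => /andP[su us].
    have [e'1 e'2] : e' <= e /\ e' <= d - `|s - t|.
      by rewrite /e' !ge_min !lexx orbT.
    split; last by apply: eZ; rewrite /ball/= ltr_norml; apply/andP; lra.
    have -> : u - t = (u - s) + (s - t) by ring.
    by rewrite (le_lt_trans (ler_normD _ _))// gtr0_norm; lra.
  have nI : nbhs t I := open_nbhs_nbhs (conj oI It).
  by apply: filterS (filterI nI nd) => u [Iu ud]; split => //; exact: fd.
Qed.

End one_variable.

(** * Linear combinations of extendable functions *)

Section extendable_combination.
Variable R : realType.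
Local Open Scope complex_scope.
Local Notation C := R[i]^o.
Implicit Types (I : set R) (f : R -> R).

Lemma extendable0 I : holomorphically_extendable I (fun=> 0).
Proof.
by exists setT, (fun=> 0); split => //; exact: openT.
Qed.

Lemma extendable_addZ I (c : R) (f f' : R -> R) :
  holomorphically_extendable I f -> holomorphically_extendable I f' ->
  holomorphically_extendable I (fun t => f t + c * f' t).
Proof.
move=> [U [h [oU hU IU hf]]] [U' [h' [oU' hU' IU' hf']]].
exists (U `&` U'), (h + cst c%:C * h'); split.
- exact: openI.
- move=> z [Uz U'z]; apply: (@derivableD _ _ _ h (cst c%:C * h') z 1 (hU _ Uz)).
  apply: (@derivableM _ _ (cst c%:C) h' z 1 _ (hU' _ U'z)).
  exact: derivable_cst.
- by move=> t It; split; [exact: IU|exact: IU'].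
- move=> t It; rewrite -[LHS]/(h t%:C + c%:C * h' t%:C) hf// hf'//.
  by apply/eqP; rewrite eq_complex/= !(mul0r, mulr0, addr0, subr0) !eqxx.
Qed.

Lemma extendable_sum I (m : nat) (c : 'I_m -> R) (F : 'I_m -> R -> R) :
  (forall j, holomorphically_extendable I (F j)) ->
  holomorphically_extendable I (fun t => \sum_(j < m) c j * F j t).
Proof.
elim: m c F => [|m ih] c F extF.
  by under [X in holomorphically_extendable _ X]eq_fun do rewrite big_ord0;
    exact: extendable0.
under [X in holomorphically_extendable _ X]eq_fun do rewrite big_ord_recr.
by apply: extendable_addZ => //; apply: (ih _ (fun j => F (widen_ord _ j))).
Qed.

End extendable_combination.

(** * The identity theorem on a box *)

Section many_variables.
Variable R : realType.
Local Notation mu := (@lebesgue_measure R).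

Lemma measurable_box (q : nat) (X : 'I_q -> set R) :
  (forall k, measurable (X k)) -> measurable (box X).
Proof.
move=> mX.
rewrite (_ : box X = \bigcap_k ((@tnth _ R ^~ k) @^-1` (X k))); last first.
  by apply/seteqP; split=> [x Xx k _|x Xx k]; [exact: Xx|exact: (Xx k I)].
apply: fin_bigcap_measurable => // k _.
by rewrite -[X in measurable X]setTI; exact: measurable_tnth.
Qed.

Lemma integral_countable_support (phi : measurableTypeR R -> \bar R) :
  measurable_fun setT phi -> (forall t, 0 <= phi t)%E ->
  countable [set t | 0 < phi t]%E -> (\int[mu]_t phi t = 0)%E.
Proof.
move=> mphi phi0 cphi.
have mN : measurable ([set t | 0 < phi t]%E : set (measurableTypeR R)).
  by apply: countable_measurable => // t; exact: measurable_set1.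
rewrite (ge0_negligible_integral mN)//; last exact: countable_lebesgue_measure0.
apply: integral0_eq => t [_ /=] /negP; rewrite -leNgt => tle0.
by apply/eqP; rewrite eq_le tle0 phi0.
Qed.

Lemma tupdate_tcons0 n (t s : R) (y : n.-tuple R) :
  tupdate (tcons (t, y)) ord0 s = tcons (s, y).
Proof.
apply: eq_from_tnth => i; rewrite tnth_mktuple.
by case: (unliftP ord0 i) => [j ->|-> //]; rewrite !tnthS.
Qed.

Lemma tupdate_tconsS n (t s : R) (y : n.-tuple R) (k : 'I_n) :
  tupdate (tcons (t, y)) (lift ord0 k) s = tcons (t, tupdate y k s).
Proof.
apply: eq_from_tnth => i; rewrite tnth_mktuple.
case: (unliftP ord0 i) => [j ->|->]; last by rewrite eq_liftF.
by rewrite (inj_eq lift_inj) !tnthS tnth_mktuple.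
Qed.

Lemma box_tcons n (X : 'I_n.+1 -> set R) t (y : n.-tuple R) :
  box X (tcons (t, y)) <-> X ord0 t /\ box (fun k => X (lift ord0 k)) y.
Proof.
split => [Xty|[Xt Xy] k].
  split; first exact: (Xty ord0).
  by move=> k; have := Xty (lift ord0 k); rewrite tnthS.
by case: (unliftP ord0 k) => [j ->|-> //]; rewrite tnthS; exact: Xy.
Qed.

(** By Tonelli, uncountably many slices [t] of the zero set have positive
    measure; on each of them [f] vanishes by induction. So every line in the
    first direction contains uncountably many zeros. *)
Lemma separately_extendable_eq0 (q : nat) (X : 'I_q -> set R)
    (f : q.-tuple R -> R) :
  (forall k, open (X k) /\ is_interval (X k)) ->
  measurable_fun (box X) f ->
  (forall (k : 'I_q) (x : q.-tuple R), (forall i, i != k -> X i (tnth x i)) ->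
    holomorphically_extendable (X k) (fun t => f (tupdate x k t))) ->
  (0 < lebesgue_tuple q [set x | box X x /\ f x = 0%R])%E ->
  forall x, box X x -> f x = 0.
Proof.
elim: q X f => [|n ih] X f oX mf ext Zpos x Xx.
  apply: contrapT => fx; move: Zpos.
  rewrite [X in lebesgue_tuple 0 X](_ : _ = set0) ?measure0 ?ltxx//.
  by apply/seteqP; split => // y [_]; rewrite (tuple0 y) -(tuple0 x).
have mX k : measurable (X k) by apply: open_measurable; case: (oX k).
pose X' k := X (lift ord0 k).
have mX' : measurable (box X') by apply: measurable_box => k; exact: mX.
pose Z := [set x | box X x /\ f x = 0].
have mZ : measurable (@tcons R n @^-1` Z).
  rewrite -[X in measurable X]setTI; apply: measurable_tcons => //.
  exact: (mf (measurable_box mX) _ (measurable_set1 0)).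
pose phi t := lebesgue_tuple n (xsection (@tcons R n @^-1` Z) t).
have unc : ~ countable [set t | 0 < phi t]%E.
  move=> /integral_countable_support intphi0; move: Zpos; rewrite -/Z.
  rewrite [X in (0 < X)%E](_ : _ = \int[mu]_t phi t)%E//.
  rewrite intphi0 ?ltxx//; first exact: measurable_fun_xsection.
have slice0 t : (0 < phi t)%E ->
    X ord0 t /\ forall y, box X' y -> f (tcons (t, y)) = 0.
  move=> phit.
  have Xt : X ord0 t.
    apply: contrapT => nXt; move: phit; rewrite /phi.
    rewrite [X in lebesgue_tuple n X](_ : _ = set0) ?measure0 ?ltxx//.
    by apply/seteqP; split => // y; rewrite /xsection/= inE => -[/box_tcons[]].
  split => //; apply: (ih X' (fun y => f (tcons (t, y)))).
  - by move=> k; exact: oX.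
  - apply: (@measurable_comp _ _ _ _ _ _ (box X) f _ (fun y => tcons (t, y))).
    + exact: measurable_box.
    + by move=> _ [y X'y <-]; exact/box_tcons.
    + exact: mf.
    + apply: measurable_funTS.
      exact: (@measurable_cons _ _ _ R (fun=> t) n id
                (measurable_cst t) (@measurable_id _ _ _)).
  - move=> k y Xy.
    rewrite (_ : (fun s => _) =
        fun s => f (tupdate (tcons (t, y)) (lift ord0 k) s)); last first.
      by apply/funext => s; rewrite tupdate_tconsS.
    apply: ext => i; case: (unliftP ord0 i) => [j ->|-> //].
    by rewrite (inj_eq lift_inj) tnthS => /Xy.
  - move: phit; rewrite /phi; congr (_ < lebesgue_tuple n _)%E.
    apply/seteqP; split => y; rewrite /xsection/= inE/=.
      by move=> [/box_tcons[]].
    by move=> [X'y fy]; split => //; exact/box_tcons.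
have -> : x = tcons (tuncons x) by rewrite tunconsK.
move: Xx; rewrite -(tunconsK x); move: (tuncons x) => [t0 y0] /box_tcons[Xt0 X'y0].
rewrite tconsK.
apply: (@extendable_eq0 _ (X ord0) (fun t => f (tcons (t, y0)))) => //.
- by case: (oX ord0).
- by case: (oX ord0).
- rewrite (_ : (fun s => _) =
      fun s => f (tupdate (tcons (t0, y0)) ord0 s)); last first.
    by apply/funext => s; rewrite tupdate_tcons0.
  apply: ext => i; case: (unliftP ord0 i) => [j ->|->]; last by rewrite eqxx.
  by move=> _; rewrite tnthS; exact: X'y0.
- apply: contra_not unc; apply: sub_countable; apply: subset_card_le.
  by move=> t /slice0[Xt ft]; split => //; exact: ft.
Qed.

End many_variables.

(** * Linear independence of identifiable densities *)

Section mixtures.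
Context d (T : measurableType d) (R : realType).
Variables (M : {measure set T -> \bar R}) (D : set T) (mD : measurable D).

Lemma mixture_density (m : nat) (lambda : 'I_m -> R)
    (P : 'I_m -> probability T R) (g : 'I_m -> T -> R) :
  (forall j, 0 <= lambda j) -> (forall j x, D x -> 0 <= g j x) ->
  (forall j, is_density M D (P j) (g j)) ->
  forall A, measurable A -> mixture lambda P A =
    (\int[M]_(x in A `&` D) (\sum_(j < m) lambda j * g j x)%R%:E)%E.
Proof.
move=> lambda0 g0 gP A mA.
have mg j : measurable_fun (A `&` D) (EFin \o g j).
  apply/measurable_EFinP; apply: (@measurable_funS _ _ _ _ D) => //.
  by case: (gP j).
have mAD : measurable (A `&` D) by exact: measurableI.
under eq_integral do rewrite -sumEFin.
rewrite ge0_integral_sum//.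
- apply: eq_bigr => j _; case: (gP j) => _ ->//.
  rewrite -ge0_integralZl//; first exact: mg.
  + by move=> x [_ Dx]; rewrite lee_fin g0.
  + by rewrite lee_fin.
- by move=> j; apply/measurable_EFinP; apply: measurable_funM => //;
    exact/measurable_EFinP.
- by move=> j x [_ Dx]; rewrite lee_fin mulr_ge0 ?g0.
Qed.

(** Adding a large constant [c] to all weights turns the vanishing linear
    combination into two mixtures of the same distributions, with positive
    weights [c + beta j] and [c]. *)
Lemma identifiable_independent (Xi : Type) (Q : Xi -> probability T R)
    (g : Xi -> T -> R) :
  identifiable Q -> (forall xi x, D x -> 0 <= g xi x) ->
  (forall xi, is_density M D (Q xi) (g xi)) ->
  forall (m : nat) (xi : 'I_m -> Xi) (beta : 'I_m -> R), injective xi ->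
  (forall x, D x -> \sum_(j < m) beta j * g (xi j) x = 0) ->
  forall j, beta j = 0.
Proof.
move=> Qid g0 gQ m xi beta xi_inj sum0.
pose c := 1 + \sum_(j < m) `|beta j|.
have c0 : 0 < c by rewrite ltr_wpDr// sumr_ge0.
have cbeta j : 0 < c + beta j.
  have : `|beta j| <= \sum_(j < m) `|beta j|.
    by rewrite (bigD1 j)//= lerDl sumr_ge0.
  by rewrite ler_norml /c => /andP[? ?]; lra.
have [|A mA|s sP] := Qid m xi (fun j => c + beta j) xi (fun=> c) xi_inj cbeta.
- by move=> j; exact: ltW.
- have mixE lambda (lambda0 : forall j, 0 <= lambda j) :=
    @mixture_density _ lambda (Q \o xi) (g \o xi) lambda0
      (fun j => g0 (xi j)) (fun j => gQ (xi j)) A mA.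
  rewrite !mixE => [|j|j]; [|exact: ltW|exact: ltW].
  apply: eq_integral => x /set_mem[_ Dx]; congr EFin.
  under eq_bigr do rewrite mulrDl.
  by rewrite big_split/= sum0// addr0.
- move=> j; have [/xi_inj sj] := sP j; rewrite -sj => cj.
  by apply: (addrI c); rewrite addr0 -cj.
Qed.

End mixtures.

Theorem theorem5p1 (R : realType) (q : nat) (X : 'I_q -> set R)
    (X_open_interval : forall k, open (X k) /\ is_interval (X k))
    (Xi : Type) (Q : Xi -> probability (q.-tuple R) R)
    (g : Xi -> q.-tuple R -> R)
    (g_gt0 : forall xi x, box X x -> 0 < g xi x)
    (g_density : forall xi, is_density (lebesgue_tuple q) (box X) (Q xi) (g xi))
    (Q_identifiable : identifiable Q)
    (g_holomorphic : forall (xi : Xi) (k : 'I_q) (x : q.-tuple R),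
      (forall i, i != k -> X i (tnth x i)) ->
      holomorphically_extendable (X k) (fun t => g xi (tupdate x k t))) :
  locally_identifiable (lebesgue_tuple q) (box X) g.
Proof.
move=> m xi beta xi_inj zeros_gt0.
have mbox : measurable (box X).
  by apply: measurable_box => k; apply: open_measurable; case: (X_open_interval k).
apply: (identifiable_independent mbox Q_identifiable _ g_density xi_inj).
  by move=> xi' x Xx; exact/ltW/g_gt0.
apply: (separately_extendable_eq0 X_open_interval _ _ zeros_gt0).
- apply: measurable_sum => j; apply: measurable_funM => //.
  by case: (g_density (xi j)).
- by move=> k x Xx; apply: extendable_sum => j; exact: g_holomorphic.
Qed.
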